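(* For every $r>1$ there exists a constant $C_r>0$ depending only on $r$ such that the following holds. Let $(a_n)_{n\in\mathbb{N}}$ be an increasing sequence of positive integers which is lacunary with growth factor $r$. Then there exists $\alpha\in\mathbb{R}$ such that for all sufficiently large $N\in\mathbb{N}$ $$G(\{\alpha a_n\}_{n\le N})\le C_r\,\frac{\log N}{N}.$$
   Context: A sequence $(a_n)_{n\in\mathbb{N}}$ is lacunary with growth factor $r>1$ if $a_{n+1}\ge r a_n$ for every $n\in\mathbb{N}$. Maximal gap: for a finite family of real numbers $z_1,\dots,z_m$ ($m\ge1$), reduce each $z_i$ modulo $1$ to a representative in $[0,1)$ and sort these representatives as $0\le y_1\le y_2\le\dots\le y_m<1$; put $y_{m+1}:=1+y_1$. Then $G(\{z_i\}_{i\le m}):=\max_{2\le k\le m+1}(y_k-y_{k-1})$ is the largest gap between neighbouring points on the unit torus. Thus $G(\{\alpha a_n\}_{n\le N})$ is the maximal gap of the points $\alpha a_1,\dots,\alpha a_N$ modulo $1$. *)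

(* Defs.v *)
From mathcomp Require Import all_boot all_order all_algebra.
From mathcomp Require Import all_classical all_reals all_analysis.

Set Implicit Arguments.
Unset Strict Implicit.
Unset Printing Implicit Defensive.

Import Order.TTheory GRing.Theory Num.Theory.
Local Open Scope ring_scope.

Definition lacunary (R : realType) (r : R) (a : nat -> nat) : Prop :=
  1 < r /\ forall n : nat, r * (a n)%:R <= (a n.+1)%:R.

Definition frac_part (R : realType) (x : R) : R := x - (Num.floor x)%:~R.

(* y is y_1 <= ... <= y_m (indexed from 0) and w is y extended with
   y_(m+1) = 1 + y_1. All the gaps are nonnegative, so for m >= 1 the initial
   value 0 of the iterated maximum does not affect it. *)
Definition max_gap (R : realType) (z : seq R) : R :=
  let y := sort <=%R [seq frac_part x | x <- z] in
  let w := rcons y (1 + y`_0) in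
  \big[Num.max/0]_(0 <= k < size y) (w`_k.+1 - w`_k).

(* Sequences are indexed from 0, so these are the points alpha a_1, ...,
   alpha a_N, with a k standing for a_(k+1). *)
Definition dilated_points (R : realType) (alpha : R) (a : nat -> nat)
    (N : nat) : seq R :=
  [seq alpha * (a n)%:R | n <- iota 0 N].

(* Main.v *)
Require Import Defs.
From mathcomp Require Import all_boot all_order all_algebra.
From mathcomp Require Import all_classical all_reals all_analysis.
From mathcomp Require Import lra zify.
Import Order.TTheory GRing.Theory Num.Theory.
Local Open Scope classical_set_scope.
Local Open Scope ring_scope.

(* If every dilation factor b_(i+1) is at least 2 / d_i times the previous one,
   then one can prescribe b_i * alpha modulo 1 up to an error d_i for all i at
   once: a closed interval of length d_i / b_i contains a full period of
   x |-> b_(i+1) * x followed by room for the next interval, so the admissible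
   intervals can be nested. In a lacunary sequence, taking one term out of
   O(j) yields such factors with precision d = 2^-j / 2, hence the 2^j dyadic
   cells of length 2^-j can all be visited among the first O(j 2^j) terms. *)

Lemma frac_part_itv {R : realType} (x : R) : 0 <= frac_part x < 1.
Proof.
by have := floor_itv x; rewrite /frac_part rmorphD /=; lra.
Qed.

Lemma frac_part_def {R : realType} {m : int} {x : R} :
  m%:~R <= x < m%:~R + 1 -> frac_part x = x - m%:~R.
Proof.
move=> hx; have hm : Num.floor x = m by apply: floor_def; rewrite rmorphD.
by rewrite /frac_part hm.
Qed.

(** Bernoulli's inequality. [K] will be a number of steps after which a lacunary sequence has at
    least doubled. *)
Lemma exists_expr_ge2 {R : realType} {r : R} :
  1 < r -> exists K : nat, 2 <= r ^+ K.
Proof.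
move=> r1; have hB (n : nat) : 1 + n%:R * (r - 1) <= r ^+ n.
  elim: n => [|n IH]; first by rewrite expr0; lra.
  have rn1 : 1 <= r ^+ n by apply: exprn_ege1; lra.
  have : 0 <= (r ^+ n - 1) * (r - 1) by apply: mulr_ge0; lra.
  by rewrite exprS -natr1; lra.
exists (Num.bound (r - 1)^-1).
apply: le_trans (hB _).
have r10 : 0 < r - 1 by lra.
have : (r - 1)^-1 < (Num.bound (r - 1)^-1)%:R.
  by apply: archi_boundP; rewrite invr_ge0 ltW.
rewrite -(ltr_pM2r r10) mulVf ?gt_eqF //; lra.
Qed.

Lemma lacunary_addn {R : realType} {r : R} {a : nat -> nat} (n s : nat) :
  lacunary r a -> r ^+ s * (a n)%:R <= (a (n + s)%N)%:R.
Proof.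
case=> r1 ha; elim: s => [|s IH]; first by rewrite expr0 mul1r addn0.
rewrite addnS; apply: le_trans (ha _).
by rewrite exprS -mulrA ler_pM2l //; lra.
Qed.

Lemma prescribed_dilates {R : realType} (b t d : nat -> R) :
  (forall i, 0 < b i) -> (forall i, 0 <= d i <= 1) ->
  (forall i, 2 * b i <= d i * b i.+1) ->
  exists alpha : R, forall i, exists m : int,
    m%:~R + t i <= alpha * b i <= m%:~R + t i + d i.
Proof.
move=> b0 d01 hb.
(* [nxt i x] is the least point [y >= x] with [y * b i] congruent to [t i] modulo 1. The nested
   intervals are [[x i, x i + d i / b i]]. *)
pose nxt (i : nat) (x : R) : R := ((Num.ceil (x * b i - t i))%:~R + t i) / b i.
pose x := fix x (n : nat) : R := if n is n'.+1 then nxt n (x n') else nxt 0 0.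
have nxtP i y : y <= nxt i y <= y + (b i)^-1.
  have bi := b0 i.
  rewrite /nxt ler_pdivlMr // ler_pdivrMr // mulrDl mulVf ?gt_eqF //.
  by have := ceil_itv (y * b i - t i); rewrite rmorphB /=; lra.
have xint i : exists m : int, x i * b i = m%:~R + t i.
  by case: i => [|i] /=; rewrite /nxt divfK ?gt_eqF //; eexists.
have xle i : x i <= x i.+1 by have /= := nxtP i.+1 (x i); lra.
(* The old length is at least [2 / b i.+1]: one period for the move to [x i.+1], and one for the new
   interval, as [d i.+1 <= 1]. *)
have xdec i : x i.+1 + d i.+1 / b i.+1 <= x i + d i / b i.
  have hi : 2 / b i.+1 <= d i / b i.
    by rewrite ler_pdivrMr // mulrAC ler_pdivlMr.
  have h2 : d i.+1 / b i.+1 <= (b i.+1)^-1.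
    rewrite ler_pdivrMr // mulVf ?gt_eqF //; by have := d01 i.+1; lra.
  have /= := nxtP i.+1 (x i); lra.
have xmono i k : x i <= x (i + k)%N.
  by elim: k => [|k IH]; rewrite ?addn0 // addnS; apply: le_trans IH (xle _).
have xbound i k : x (i + k)%N + d (i + k)%N / b (i + k)%N <= x i + d i / b i.
  elim: k => [|k IH]; rewrite ?addn0 // addnS.
  exact: le_trans (xdec _) IH.
have db0 i : 0 <= d i / b i.
  by apply: divr_ge0; [have := d01 i; lra|exact: ltW].
have ub i : ubound (range x) (x i + d i / b i).
  move=> _ [k _ <-]; have [ik|ki] := leqP i k.
    by have := xbound i (k - i)%N; rewrite subnKC // ; have := db0 k; lra.
  by have := xmono k (i - k)%N; rewrite subnKC ?(ltnW ki) //; have := db0 i; lra.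
have ne : range x !=set0 by exists (x 0%N); exists 0%N.
(* The supremum of the left ends lies below every right end, hence in all the intervals. *)
exists (sup (range x)) => i; have [m hm] := xint i; exists m.
have h1 : x i <= sup (range x).
  apply: sup_upper_bound; last by exists i.
  by split => //; exists (x 0%N + d 0%N / b 0%N); exact: ub.
have h2 : sup (range x) <= x i + d i / b i by apply: ge_sup.
rewrite -hm ler_pM2r // h1 /=.
have -> : x i * b i + d i = (x i + d i / b i) * b i.
  by rewrite mulrDl divfK ?gt_eqF.
by rewrite ler_pM2r.
Qed.

(** A gap longer than two cells would contain a whole cell, which has a point in it. *)
Lemma max_gap_cells {R : realType} (z : seq R) (M : nat) :
  (0 < M)%N ->
  (forall k, (k < M)%N ->
    exists2 x, x \in z & k%:R <= frac_part x * M%:R < k%:R + 1) ->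
  max_gap z <= 2 / M%:R.
Proof.
move=> M0 hz; rewrite /max_gap.
set y := sort _ _.
have ys : sorted <=%R y by apply: sort_sorted; exact: le_total.
have MR0 : 0 < M%:R :> R by rewrite ltr0n.
have cell k : (k < M)%N ->
    exists2 q, (q < size y)%N & k%:R <= y`_q * M%:R < k%:R + 1.
  move=> /hz [x xz hx].
  have fy : frac_part x \in y by rewrite mem_sort map_f.
  by exists (index (frac_part x) y); rewrite ?index_mem // nth_index.
have y01 q : (q < size y)%N -> 0 <= y`_q < 1.
  move=> /(mem_nth 0); rewrite mem_sort => /mapP[x _ ->].
  exact: frac_part_itv.
have mono p q : (p <= q)%N -> (q < size y)%N -> y`_p <= y`_q.
  move=> pq qs; apply: le_sorted_leq_nth => //.
  by rewrite inE (leq_ltn_trans pq).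
rewrite big_nat; apply: bigmax_le => [|k /= ks].
  by apply: divr_ge0; rewrite // ltW.
rewrite ler_pdivlMr // !nth_rcons ks.
have [/andP[u0 u1]] := y01 _ ks.
(* The gap across 0 is bounded separately, by the points in the first and last cells. *)
have [ks'|ks'] := ltnP k.+1 (size y); last first.
  have -> : k.+1 == size y by rewrite eqn_leq ks' ks.
  have [q qs hq] := cell _ M0.
  have M1 : (M.-1 < M)%N by rewrite prednK.
  have [p ps] := cell _ M1.
  have -> : M.-1%:R = M%:R - 1 :> R by rewrite -subn1 natrB.
  move=> hp.
  have h1 : y`_0 * M%:R <= y`_q * M%:R by rewrite ler_pM2r // mono.
  have h2 : y`_p * M%:R <= y`_k * M%:R.
    by rewrite ler_pM2r // mono // -ltnS (leq_trans ps ks').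
  lra.
rewrite leNgt; apply/negP => hgap.
have v1 : y`_k.+1 * M%:R < M%:R by rewrite gtr_pMl //; case/andP: (y01 _ ks').
have [n hn] : exists n : nat, n%:R <= y`_k * M%:R < n%:R + 1.
  exists (Num.truncn (y`_k * M%:R)); rewrite natr1.
  by apply: truncn_itv; apply: mulr_ge0 => //; exact: ltW.
have nM : (n.+1 < M)%N by rewrite -(ltr_nat R) -natr1; lra.
have [q qs] := cell _ nM; rewrite -natr1 => hq.
have [qk|kq] := leqP q k.
  have : y`_q * M%:R <= y`_k * M%:R by rewrite ler_pM2r // mono.
  lra.
have : y`_k.+1 * M%:R <= y`_q * M%:R by rewrite ler_pM2r // mono.
lra.
Qed.

Theorem theorem2p2 (R : realType) (r : R) (hr : 1 < r) :
  exists C : R, 0 < C /\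
    forall a : nat -> nat,
      increasing_seq a -> (forall n : nat, (0 < a n)%N) -> lacunary r a ->
      exists alpha : R,
        \forall N \near \oo,
          max_gap (dilated_points alpha a N) <= C * (ln N%:R / N%:R).
Proof.
have [K hK] := exists_expr_ge2 hr.
have K0 : (0 < K)%N by case: K hK => // ; rewrite expr0; lra.
have ln2 : 0 < ln 2 :> R by rewrite ln_gt0 // ltr1n.
have KR0 : 0 < K%:R :> R by rewrite ltr0n.
exists (24 * K%:R / ln 2); split; first by rewrite divr_gt0 // mulr_gt0.
move=> a _ a0 ha.
(* Step i = 2^j + k, with k < 2^j, aims at the k-th dyadic cell of level j. *)
pose l i := trunc_log 2 i.
pose n i := (K * (i * (l i + 2)))%N.
pose t i : R := (i - 2 ^ l i)%:R / 2 ^+ l i.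
pose d i : R := (2 ^+ (l i).+1)^-1.
have pow0 j : 0 < 2 ^+ j :> R by rewrite exprn_gt0.
have pow1 j : 1 <= 2 ^+ j :> R by apply: exprn_ege1; lra.
have [||| alpha hal] := @prescribed_dilates R (fun i => (a (n i))%:R) t d.
- by move=> i; rewrite ltr0n.
- by move=> i; rewrite /d invr_ge0 ltW //= invf_le1.
- move=> i; rewrite /d ler_pdivlMl // mulrA -exprSr.
  (* Since [2 <= r ^+ K], [K * (l i).+2] steps of the sequence give a growth factor [2 ^+ (l i).+2],
     which is [2 / d i]. *)
  have hln : (n i + K * (l i).+2 <= n i.+1)%N.
    rewrite /n -mulnDr leq_mul2l; apply/orP; right.
    have : (l i <= l i.+1)%N by apply: leq_trunc_log.
    move: (l i) (l i.+1) => p q pq; nia.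
  apply: (@le_trans _ _ (r ^+ (K * (l i).+2) * (a (n i))%:R)).
    rewrite ler_pM2r ?ltr0n // exprM lerXn2r // nnegrE; lra.
  apply: le_trans (lacunary_addn _ _ ha) _.
  have [s ->] : exists s, n i.+1 = (n i + K * (l i).+2 + s)%N.
    by exists (n i.+1 - (n i + K * (l i).+2))%N; rewrite subnKC.
  apply: le_trans (lacunary_addn _ s ha).
  by rewrite ler_peMl // exprn_ege1 // ltW.
exists alpha; near=> N.
have NK : (4 * K <= N)%N by near: N; exact: nbhs_infty_ge.
(* [P j] puts all of level [j], that is [i < 2 ^ j.+1], among the first [N] terms. The largest such
   [j] is used; [NK] is [P 0]. *)
pose P j := (K * (2 ^ j.+1 * (j + 2)) <= N)%N.
have P0 : exists j, P j by exists 0%N; rewrite /P; lia.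
have Pb j : P j -> (j <= N)%N.
  move=> Pj; have := ltn_expl j.+1 (isT : (1 < 2)%N).
  move: Pj; rewrite /P; move: (2 ^ j.+1)%N => q; nia.
case: (ex_maxnP P0 Pb) => j Pj Pmax.
have NP : (N < K * (2 ^ j.+2 * (j + 3)))%N.
  rewrite ltnNge; apply/negP => h; suff /Pmax : P j.+1 by rewrite ltnn.
  by move: h; rewrite /P addSnnS.
have Mgap : max_gap (dilated_points alpha a N) <= 2 / (2 ^ j)%:R.
  apply: max_gap_cells => [|k kM]; first by rewrite expn_gt0.
  pose i := (2 ^ j + k)%N.
  have li : l i = j.
    by apply: trunc_log_eq => //; rewrite expnS /i; lia.
  have niN : (n i < N)%N.
    rewrite (leq_trans _ Pj) // /n li ltn_mul2l K0 ltn_mul2r addn2 /=.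
    by rewrite expnS /i; lia.
  exists (alpha * (a (n i))%:R).
    by apply/mapP; exists (n i); rewrite ?mem_iota.
  have [m] := hal i.
  have -> : t i = k%:R / 2 ^+ j by rewrite /t li /i addKn.
  have -> : d i = (2 ^+ j)^-1 / 2 by rewrite /d li exprS invfM mulrC.
  set A := alpha * _; rewrite natrX; set M : R := 2 ^+ j => hA.
  have M0 : 0 < M by exact: pow0.
  have hk : k%:R + 1 <= M by rewrite /M -natrX natr1 ler_nat.
  (* The error is half a cell, so the point stays in the left half of cell [k], off its excluded
     right end. *)
  have hB : k%:R <= (A - m%:~R) * M <= k%:R + 2^-1.
    move: hA => /andP[h1 h2].
    have <- : (k%:R / M) * M = k%:R by rewrite divfK // gt_eqF.
    have e : M^-1 * M = 1 by rewrite mulVf // gt_eqF.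
    have -> : k%:R / M * M + 2^-1 = (k%:R / M + M^-1 / 2) * M.
      by rewrite mulrDl; congr (_ + _); rewrite mulrAC e mul1r.
    by rewrite !ler_pM2r //; lra.
  have kR : 0 <= k%:R :> R by [].
  have h0 : 0 <= A - m%:~R by rewrite -(pmulr_lge0 _ M0); lra.
  have h1 : A - m%:~R < 1 by rewrite -(ltr_pM2r M0); lra.
  by rewrite (@frac_part_def _ m) //; lra.
apply: le_trans Mgap _.
have N0 : 0 < N%:R :> R by rewrite ltr0n; lia.
have lnN : (j.+1)%:R * ln 2 <= ln N%:R :> R.
  have -> : (j.+1)%:R * ln 2 = ln (2 ^+ j.+1) :> R by rewrite lnXn // mulr_natl.
  rewrite ler_ln ?posrE // -natrX ler_nat; apply: leq_trans Pj.
  by move: (2 ^ j.+1)%N => q; nia.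
(* Maximality of [j] with [j + 3 <= 3 * j.+1] gives the factor 12; the 2 of the gap bound and [lnN]
   turn it into [24 * K / ln 2]. *)
have NR : N%:R <= K%:R * (12 * 2 ^+ j * (j.+1)%:R) :> R.
  rewrite -natrX -!natrM ler_nat; apply: leq_trans (ltnW NP) _.
  by rewrite !expnS; move: (2 ^ j)%N => q; nia.
rewrite natrX ler_pdivrMr //.
have -> : 24 * K%:R / ln 2 * (ln N%:R / N%:R) * 2 ^+ j =
   24 * K%:R * 2 ^+ j * ln N%:R / (ln 2 * N%:R) :> R.
  by rewrite invfM; move: (ln 2)^-1 (N%:R^-1) => u v; lra.
rewrite ler_pdivlMr ?mulr_gt0 //.
apply: (@le_trans _ _ (2 * (ln 2 * (K%:R * (12 * 2 ^+ j * (j.+1)%:R))))).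
  by rewrite !ler_pM2l.
have : 24 * K%:R * 2 ^+ j * (j.+1%:R * ln 2) <= 24 * K%:R * 2 ^+ j * ln N%:R :> R.
  by rewrite ler_pM2l // !mulr_gt0.
lra.
Unshelve. all: by end_near. Qed.
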